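(* The cyclic, cyclic-dihedral, $8$-dihedral, $12$-dihedral and tetrahedral tori are the unique (up to biregular diffeomorphisms) quaternionic tori $T$ with $Aut(T)\ne\{\pm1\}$. That is, a quaternionic torus $T$ satisfies $Aut(T)\neq\{\pm1\}$ if and only if $Aut(T)$ is isomorphic to one of the groups $2C_3$, $2C_2$, $2D_4$, $2D_6$, $2\mathbb T$.
   Context: $\mathbb H$ is the skew field of quaternions, $\mathbb S=\{q\in\mathbb H:q^2=-1\}$, $\mathbb S^3=\{q\in\mathbb H:|q|=1\}$. A quaternionic torus is a quotient $T=\mathbb H/L$ with $L$ a rank-4 lattice, i.e. the additive subgroup of $\mathbb H$ generated by four $\mathbb R$-linearly independent elements. The group $Aut(T)$ of biregular automorphisms of $T=\mathbb H/L$ is the group (under composition) of maps $F(q)=qa$ with $a\in\mathbb S^3$ and $F(L)=L$; $\{\pm1\}$ denotes its subgroup $\{q\mapsto q,\ q\mapsto-q\}$. Let $I,J\in\mathbb S$ be orthogonal, $K=IJ$ and $e^{\alpha I}=\cos\alpha+I\sin\alpha$. As subgroups of $\mathbb S^3$: $2C_2$ is generated by $I$ (cyclic of order 4); $2C_3$ is generated by $e^{\pi I/3}$ (cyclic of order 6); $2D_4$ is generated by $I,J$ (quaternion group of order 8); $2D_6$ is generated by $e^{\pi I/3},J$ (order 12); $2\mathbb T$ is generated by $I$ and $\frac{-1+I+J+K}{2}$ (binary tetrahedral group, order 24). A quaternionic torus $T$ is called cyclic if $Aut(T)\cong2C_3$, cyclic-dihedral if $Aut(T)\cong 2C_2$,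 $8$-dihedral if $Aut(T)\cong2D_4$, $12$-dihedral if $Aut(T)\cong2D_6$, tetrahedral if $Aut(T)\cong2\mathbb T$. *)

(* Defs.v *)
From HB Require Import structures.
From mathcomp Require Import all_boot all_order all_algebra.
From mathcomp Require Import all_classical all_reals all_analysis.
From mathcomp Require Import ring lra.

Set Implicit Arguments.
Unset Strict Implicit.
Unset Printing Implicit Defensive.

Import Order.TTheory GRing.Theory Num.Theory.

Local Open Scope classical_set_scope.
Local Open Scope ring_scope.

(* [Quat a b c d] stands for a + b i + c j + d k. *)
Record quat (R : Type) : Type := Quat { qre : R; qi : R; qj : R; qk : R }.

Section QuatChoice.
Variable R : Type.

Definition quat_to_prod (q : quat R) : R * R * R * R :=
  (qre q, qi q, qj q, qk q).

Definition quat_of_prod (x : R * R * R * R) : quat R :=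
  let: (a, b, c, d) := x in Quat a b c d.

Lemma quat_to_prodK : cancel quat_to_prod quat_of_prod.
Proof. by case. Qed.

End QuatChoice.

HB.instance Definition _ (R : eqType) :=
  Equality.copy (quat R) (can_type (@quat_to_prodK R)).
HB.instance Definition _ (R : choiceType) :=
  Choice.copy (quat R) (can_type (@quat_to_prodK R)).

Section QuatAlgebra.
Variable R : realFieldType.
Implicit Types p q r : quat R.

Lemma quat_eq p q :
  qre p = qre q -> qi p = qi q -> qj p = qj q -> qk p = qk q -> p = q.
Proof. by case: p q => [a b c d] [a' b' c' d'] /= -> -> -> ->. Qed.

Definition quat_zero : quat R := Quat 0 0 0 0.

Definition quat_opp q := Quat (- qre q) (- qi q) (- qj q) (- qk q).

Definition quat_add p q :=
  Quat (qre p + qre q) (qi p + qi q) (qj p + qj q) (qk p + qk q).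

Lemma quat_addA : associative quat_add.
Proof. by move=> p q r; apply: quat_eq => /=; rewrite addrA. Qed.

Lemma quat_addC : commutative quat_add.
Proof. by move=> p q; apply: quat_eq => /=; rewrite addrC. Qed.

Lemma quat_add0 : left_id quat_zero quat_add.
Proof. by move=> p; apply: quat_eq => /=; rewrite add0r. Qed.

Lemma quat_addN : left_inverse quat_zero quat_opp quat_add.
Proof. by move=> p; apply: quat_eq => /=; rewrite addNr. Qed.

HB.instance Definition _ := GRing.isZmodule.Build (quat R)
  quat_addA quat_addC quat_add0 quat_addN.

Definition quat_one : quat R := Quat 1 0 0 0.

Definition quat_mul p q :=
  Quat (qre p * qre q - qi p * qi q - qj p * qj q - qk p * qk q)
       (qre p * qi q + qi p * qre q + qj p * qk q - qk p * qj q)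
       (qre p * qj q - qi p * qk q + qj p * qre q + qk p * qi q)
       (qre p * qk q + qi p * qj q - qj p * qi q + qk p * qre q).

Lemma quat_mulA : associative quat_mul.
Proof. by move=> p q r; apply: quat_eq => /=; ring. Qed.

Lemma quat_mul1l : left_id quat_one quat_mul.
Proof. by move=> p; apply: quat_eq => /=; ring. Qed.

Lemma quat_mul1r : right_id quat_one quat_mul.
Proof. by move=> p; apply: quat_eq => /=; ring. Qed.

Lemma quat_mulDl : left_distributive quat_mul +%R.
Proof. by move=> p q r; apply: quat_eq => /=; ring. Qed.

Lemma quat_mulDr : right_distributive quat_mul +%R.
Proof. by move=> p q r; apply: quat_eq => /=; ring. Qed.

Lemma quat_one_neq0 : quat_one != 0.
Proof. by apply/eqP => /(congr1 (@qre R)) /= /eqP; rewrite oner_eq0. Qed.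

HB.instance Definition _ := GRing.Zmodule_isNzRing.Build (quat R)
  quat_mulA quat_mul1l quat_mul1r quat_mulDl quat_mulDr quat_one_neq0.

Definition quat_scale (t : R) q :=
  Quat (t * qre q) (t * qi q) (t * qj q) (t * qk q).

Lemma quat_scaleA t s q :
  quat_scale t (quat_scale s q) = quat_scale (t * s) q.
Proof. by apply: quat_eq => /=; rewrite mulrA. Qed.

Lemma quat_scale1 : left_id 1 quat_scale.
Proof. by move=> p; apply: quat_eq => /=; rewrite mul1r. Qed.

Lemma quat_scaleDr : right_distributive quat_scale +%R.
Proof. by move=> t p q; apply: quat_eq => /=; rewrite mulrDr. Qed.

Lemma quat_scaleDl q : {morph quat_scale^~ q : t s / t + s}.
Proof. by move=> t s; apply: quat_eq => /=; rewrite mulrDl. Qed.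

HB.instance Definition _ := GRing.Zmodule_isLmodule.Build R (quat R)
  quat_scaleA quat_scale1 quat_scaleDr quat_scaleDl.

Lemma quat_scaleAl (t : R) p q : t *: (p * q) = (t *: p) * q.
Proof. by apply: quat_eq => /=; ring. Qed.

HB.instance Definition _ :=
  GRing.Lmodule_isLalgebra.Build R (quat R) quat_scaleAl.

Lemma quat_scaleAr (t : R) p q : t *: (p * q) = p * (t *: q).
Proof. by apply: quat_eq => /=; ring. Qed.

HB.instance Definition _ :=
  GRing.Lalgebra_isAlgebra.Build R (quat R) quat_scaleAr.

Definition quat_dot p q : R :=
  qre p * qre q + qi p * qi q + qj p * qj q + qk p * qk q.

Definition quat_conj q := Quat (qre q) (- qi q) (- qj q) (- qk q).

Definition quat_inv q : quat R := (quat_dot q q)^-1 *: quat_conj q.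

Lemma quat_dot_eq0 q : (quat_dot q q == 0) = (q == 0).
Proof.
apply/eqP/eqP => [|->]; last by rewrite /quat_dot /= !mulr0 !addr0.
case: q => a b c d; rewrite /quat_dot /= -!expr2 => h.
have sqz (x : R) : x ^+ 2 <= 0 -> x = 0.
  by move=> xle; apply/eqP; rewrite -sqrf_eq0 eq_le xle sqr_ge0.
have := (sqr_ge0 a, sqr_ge0 b, sqr_ge0 c, sqr_ge0 d).
by move=> [[[a0 b0] c0] d0]; apply: quat_eq => /=; apply: sqz; lra.
Qed.

Lemma quat_mulVq : {in [pred q | q != 0], left_inverse 1 quat_inv *%R}.
Proof.
move=> q; rewrite inE -quat_dot_eq0 /quat_inv -quat_scaleAl => q0.
apply: (canLR (scalerK q0)).
by apply: quat_eq; rewrite /quat_dot /=; ring.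
Qed.

Lemma quat_mulqV : {in [pred q | q != 0], right_inverse 1 quat_inv *%R}.
Proof.
move=> q; rewrite inE -quat_dot_eq0 /quat_inv -quat_scaleAr => q0.
apply: (canLR (scalerK q0)).
by apply: quat_eq; rewrite /quat_dot /=; ring.
Qed.

Lemma quat_unitP q p : p * q = 1 /\ q * p = 1 -> q != 0.
Proof.
by move=> [pq _]; apply/eqP => q0; move/eqP: pq; rewrite q0 mulr0 eq_sym oner_eq0.
Qed.

Lemma quat_inv_out : {in [predC [pred q | q != 0]], quat_inv =1 id}.
Proof.
by move=> q; rewrite !inE negbK => /eqP ->; rewrite /quat_inv;
  apply: quat_eq => /=; ring.
Qed.

HB.instance Definition _ := GRing.NzRing_hasMulInverse.Build (quat R)
  quat_mulVq quat_mulqV quat_unitP quat_inv_out.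

Fact quat_vect_iso : Vector.axiom 4 (quat R).
Proof.
exists (fun q => \row_(i < 4) [:: qre q; qi q; qj q; qk q]`_i).
  move=> t p q; apply/rowP => i; rewrite !mxE.
  by case: i => [[|[|[|[|//]]]] ?].
exists (fun v : 'rV[R]_4 => Quat (v 0 (inord 0)) (v 0 (inord 1))
                                 (v 0 (inord 2)) (v 0 (inord 3))).
  by case=> a b c d; apply: quat_eq; rewrite /= mxE inordK.
move=> v; apply/rowP => i; rewrite mxE.
by case: i => [[|[|[|[|//]]]] ?] /=; congr (v 0 _); apply: val_inj;
  rewrite /= inordK.
Qed.

HB.instance Definition _ := Lmodule_hasFinDim.Build R (quat R) quat_vect_iso.

End QuatAlgebra.

Section Torus.
Variable R : realType.
Local Notation H := (quat R).
Implicit Types (I J a q : H) (L A G : set H).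

Definition quat_norm q : R := Num.sqrt (quat_dot q q).

Definition imag_units : set H := [set q | q ^+ 2 = -1].

Definition unit_quats : set H := [set q | quat_norm q = 1].

Definition lattice4 L : Prop :=
  exists2 v : 4.-tuple H, free v & L = [set q | inIntSpan v q].

(* The automorphisms of H/L are represented by their linear lifts to H. *)
Definition Aut_torus L : set (H -> H) :=
  [set F | exists2 a, unit_quats a & F = (fun q => q * a) /\ F @` L = L].

Definition pm_id : set (H -> H) := [set id; -%R].

Definition subgroup_S3 G : Prop :=
  [/\ G `<=` unit_quats, G 1, {in G &, forall p q, G (p * q)}
    & {in G, forall q, G q^-1}].

Definition gen_S3 A : set H := smallest subgroup_S3 A.

Definition quat_exp (t : R) I : H := cos t *: 1 + sin t *: I.

Definition bin_C2 I := gen_S3 [set I].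

Definition bin_C3 I := gen_S3 [set quat_exp (pi / 3) I].

Definition bin_D4 I J := gen_S3 [set I; J].

Definition bin_D6 I J := gen_S3 [set quat_exp (pi / 3) I; J].

Definition bin_T I J := gen_S3 [set I; 2^-1 *: (-1 + I + J + I * J)].

Definition set_isog (S T : Type) (opS : S -> S -> S) (opT : T -> T -> T)
    (X : set S) (Y : set T) : Prop :=
  exists2 f : S -> T, set_bij X Y f &
    {in X &, {morph f : x y / opS x y >-> opT x y}}.

Definition Aut_isog L G : Prop :=
  set_isog (fun F F' : H -> H => F \o F') *%R (Aut_torus L) G.

Definition cyclic_torus I L := Aut_isog L (bin_C3 I).

Definition cyclic_dihedral_torus I L := Aut_isog L (bin_C2 I).

Definition dihedral8_torus I J L := Aut_isog L (bin_D4 I J).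

Definition dihedral12_torus I J L := Aut_isog L (bin_D6 I J).

Definition tetrahedral_torus I J L := Aut_isog L (bin_T I J).

End Torus.

(* Main.v *)
From HB Require Import structures.
Require Import Defs.
From mathcomp Require Import all_boot all_order all_algebra.
From mathcomp Require Import all_classical all_reals all_analysis.
From mathcomp Require Import ring lra zify.

(** Right multiplication by [a] identifies the automorphism group of [H/L] with
    the stabilizer [G] of the lattice [L] in [S^3], up to reversing products;
    composing with inversion gives an honest isomorphism.

    The crystallographic restriction is elementary here.  If [a] stabilizes
    [L] then so does [a^-1], which is the conjugate of [a], so that
    [x * a + x * a^-1 = (2 * Re a) *: x] is in [L] for all [x] in [L].  Taking
    for [x] an element of a basis of [L] shows that [2 * Re a] is an integer
    ([stabilizer_int]).  Since [Re (a * b^-1)] is the inner product of [a] and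
    [b], twice the inner product of any two elements of [G] is an integer.

    It remains to classify the subgroups of [S^3] with this property that
    contain [-1].  A pair of orthonormal imaginary units [u, v] (a frame)
    determines an isometric automorphism of the quaternions that maps [i, j] to
    [u, v]; so any frame may be moved to the standard one, which reduces the
    classification to computations with coordinates.
    - If [G] contains a frame, move it to [i, j].  The doubled coordinates of
      all elements are integers, so [G] consists of unit Hurwitz quaternions.
      It is the quaternion group, unless it has an element with all coordinates
      [+-1/2]; the other elements of this form are then in [G] too, because
      conjugations by [i] and [j] and inversion, with [-1], generate all changes
      of sign, and [G] is the binary tetrahedral group
      ([hurwitz_classification]).
    - Otherwise, if [G] has an element of trace 1, move it to
      [w = exp (pi i / 3)].  For [h] in [G], twice the inner products of [h]
      with [1] and [w] are integers [m, n], and the squared length of the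
      projection of [h] to the plane of [1] and [i] is [(m^2 - m n + n^2) / 3].
      It is thus 0, 1/3 or 1.  The value 1/3 would make the conjugates
      [h], [w h w^-1], [w^2 h w^-2] pairwise orthogonal and provide a frame in
      [G].  So [h] is either orthogonal to the plane or a power of [w], and [G]
      is [2C_3] or [2D_6] ([hexagonal_classification],
      [hexagonal_classificationJ]).
    - Otherwise all elements other than [1] and [-1] are imaginary units, any
      two of which are equal or opposite, and [G] is [2C_2]
      ([cyclic4_classification]).

    Frames also account for the choice of [I, J] in the statement: the frame
    map of [I, J] carries the standard copy of each group to the one generated
    in terms of [I, J].  Conversely, none of the five groups is isomorphic to
    [{id, -id}] since each has an element whose square is not 1. *)

Set Implicit Arguments.
Unset Strict Implicit.
Unset Printing Implicit Defensive.

Import Order.TTheory GRing.Theory Num.Theory.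

Local Open Scope classical_set_scope.
Local Open Scope ring_scope.

Section Torus.
Variable R : realType.
Local Notation H := (quat R).
Implicit Types (p q u v w g h : H) (A B S G L : set H).

(** * Unit quaternions and imaginary units *)

Lemma sqr_le0_eq0 (x : R) : x ^+ 2 <= 0 -> x = 0.
Proof. by move=> x0; apply/eqP; rewrite -sqrf_eq0 eq_le x0 sqr_ge0. Qed.

Lemma unit_quatsE q : unit_quats q <-> quat_dot q q = 1.
Proof.
rewrite /unit_quats /= /quat_norm; split=> [q1|->]; last exact: sqrtr1.
have q0 : 0 <= quat_dot q q.
  by rewrite /quat_dot -!expr2 !addr_ge0 ?sqr_ge0.
by rewrite -(sqr_sqrtr q0) q1 expr1n.
Qed.

Lemma quat_inv_unit q : quat_dot q q = 1 -> q^-1 = quat_conj q.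
Proof. by move=> q1; rewrite /GRing.inv /= /quat_inv q1 invr1 scale1r. Qed.

Lemma quat_dot_mul p q :
  quat_dot (p * q) (p * q) = quat_dot p p * quat_dot q q.
Proof. by rewrite /quat_dot /=; ring. Qed.

Lemma quat_dot_conj q : quat_dot (quat_conj q) (quat_conj q) = quat_dot q q.
Proof. by rewrite /quat_dot /=; ring. Qed.

Lemma quat_neq0_unit q : q != 0 -> q \is a GRing.unit.
Proof. by []. Qed.

Lemma unit_quat_unit q : quat_dot q q = 1 -> q \is a GRing.unit.
Proof.
by move=> q1; apply: quat_neq0_unit; rewrite -quat_dot_eq0 q1 oner_neq0.
Qed.

(** The imaginary parts of [q ^+ 2 = -1] read [2 * qre q * qi q = 0] and so on;
    if [qre q] were not 0 then [q] would be a real number of square [-1]. *)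
Lemma imag_unitsE q : imag_units q <-> qre q = 0 /\ quat_dot q q = 1.
Proof.
rewrite /imag_units /= expr2; case: q => a b c d; rewrite /quat_dot /=.
split=> [e|[-> e]]; last by apply: quat_eq => /=; lra.
have /= ea := congr1 (@qre R) e; have /= eb := congr1 (@qi R) e.
have /= ec := congr1 (@qj R) e; have /= ed := congr1 (@qk R) e.
have [a0|a0] := eqVneq a 0; first by split=> //; move: ea; rewrite a0; lra.
have z (x : R) : a * x + x * a = 0 -> x = 0.
  rewrite (mulrC x) -mulr2n -mulrnAl => /eqP.
  by rewrite mulf_eq0 mulrn_eq0 (negPf a0) /= => /eqP.
have b0 : b = 0 by apply: z; lra.
have c0 : c = 0 by apply: z; lra.
have d0 : d = 0 by apply: z; lra.
by exfalso; have := sqr_ge0 a; rewrite expr2; move: ea; rewrite b0 c0 d0; lra.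
Qed.

(** * Subgroups of the unit sphere *)

Lemma subgroup_S3_unit_quats : subgroup_S3 (@unit_quats R).
Proof.
split=> //.
- by apply/unit_quatsE; rewrite /quat_dot /=; ring.
- move=> p q; rewrite !in_setE => /unit_quatsE p1 /unit_quatsE q1.
  by apply/unit_quatsE; rewrite quat_dot_mul p1 q1 mulr1.
- move=> q; rewrite !in_setE => /unit_quatsE q1.
  by apply/unit_quatsE; rewrite quat_inv_unit // quat_dot_conj.
Qed.

Section Subgroup.
Variables (S : set H) (Ssub : subgroup_S3 S).

Lemma S3_1 : S 1. Proof. by case: Ssub. Qed.

Lemma S3_M p q : S p -> S q -> S (p * q).
Proof. by case: Ssub => _ _ m _ Sp Sq; apply: m; rewrite in_setE. Qed.

Lemma S3_V q : S q -> S q^-1.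
Proof. by case: Ssub => _ _ _ i Sq; apply: i; rewrite in_setE. Qed.

Lemma S3_unit q : S q -> quat_dot q q = 1.
Proof. by case: Ssub => s _ _ _ /s /unit_quatsE. Qed.

Lemma S3_conj q : S q -> S (quat_conj q).
Proof. by move=> Sq; rewrite -quat_inv_unit ?S3_unit //; apply: S3_V. Qed.

End Subgroup.

Lemma subgroup_S3_gen A :
  A `<=` @unit_quats R -> subgroup_S3 (gen_S3 A).
Proof.
move=> Aunit; split.
- by apply: smallest_sub => //; exact: subgroup_S3_unit_quats.
- by move=> S [Ssub _]; exact: S3_1.
- move=> p q; rewrite !in_setE => gp gq S SA; have [Ssub _] := SA.
  by apply: S3_M => //; [apply: gp | apply: gq].
- move=> q; rewrite !in_setE => gq S SA; have [Ssub _] := SA.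
  by apply: S3_V => //; apply: gq.
Qed.

Lemma gen_S3_sub A S : subgroup_S3 S -> A `<=` S -> gen_S3 A `<=` S.
Proof. exact: smallest_sub. Qed.

Lemma sub_gen_S3 A : A `<=` gen_S3 A.
Proof. exact: sub_gen_smallest. Qed.

(** * Orthonormal pairs of imaginary units *)

Definition frame u v := [/\ imag_units u, imag_units v & quat_dot u v = 0].

Definition frame_map u v q : H :=
  qre q *: 1 + qi q *: u + qj q *: v + qk q *: (u * v).

(** Left inverse of [frame_map u v]: the Fourier coefficients of [q] in the
    orthonormal basis [1, u, v, u * v]. *)
Definition frame_coord u v q : H :=
  Quat (qre q) (quat_dot q u) (quat_dot q v) (quat_dot q (u * v)).

Lemma frame_map_linear u v : linear (frame_map u v).
Proof.
move=> t p q; rewrite /frame_map; move: (u * v) => k.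
by apply: quat_eq => /=; ring.
Qed.

HB.instance Definition _ u v :=
  GRing.isLinear.Build R H H *:%R (frame_map u v) (frame_map_linear u v).

Definition quat_i : H := Quat 0 1 0 0.
Definition quat_j : H := Quat 0 0 1 0.

Lemma frame_map1 u v : frame_map u v 1 = 1.
Proof. by apply: quat_eq => /=; ring. Qed.

Lemma frame_mapI u v : frame_map u v quat_i = u.
Proof.
by rewrite /frame_map; move: (u * v) => k; apply: quat_eq => /=; ring.
Qed.

Lemma frame_mapJ u v : frame_map u v quat_j = v.
Proof.
by rewrite /frame_map; move: (u * v) => k; apply: quat_eq => /=; ring.
Qed.

Lemma frame_std : frame quat_i quat_j.
Proof.
by split; rewrite ?imag_unitsE /quat_dot /=; [split|split|]=> //; ring.
Qed.

Section Frame.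
Variables (u v : H) (fuv : frame u v).

Lemma frame_rel : [/\ u * u = -1, v * v = -1 & v * u = - (u * v)].
Proof.
case: fuv => hu hv uv0; split; [by rewrite -expr2|by rewrite -expr2|].
have [/imag_unitsE [ur _] /imag_unitsE [vr _]] := (hu, hv).
move: uv0; rewrite /quat_dot => uv0.
by apply: quat_eq => /=; move: uv0; rewrite ur vr => uv0; [lra|ring..].
Qed.

(** The multiplication table of [1, u, v, u * v] is that of [1, i, j, k] and
    follows from [frame_rel]. *)
Lemma frame_mapM p q :
  frame_map u v (p * q) = frame_map u v p * frame_map u v q.
Proof.
have [uu vv vu] := frame_rel.
rewrite /frame_map; move ek : (u * v) => k.
rewrite ek in vu.
have uk : u * k = - v by rewrite -ek mulrA uu mulN1r.
have ku : k * u = v by rewrite -ek -mulrA vu mulrN uk opprK.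
have kv : k * v = - u by rewrite -ek -mulrA vv mulrN1.
have vk : v * k = u by rewrite -ek mulrA vu mulNr kv opprK.
have kk : k * k = -1 by rewrite -{1}ek -mulrA vk uu.
rewrite !(mulrDl, mulrDr) -!(scalerAl, scalerAr) !mul1r !mulr1.
rewrite uu vv ek vu uk ku kv vk kk.
by apply: quat_eq => /=; ring.
Qed.

Lemma frame_dots (k := u * v) :
  [/\ qre u = 0, qre v = 0 & qre k = 0] /\
  [/\ quat_dot u u = 1, quat_dot v v = 1, quat_dot k k = 1,
      quat_dot u v = 0 & quat_dot u k = 0 /\ quat_dot v k = 0].
Proof.
case: fuv => /imag_unitsE [ur u1] /imag_unitsE [vr v1] uv0.
split; split=> //; rewrite /k.
- by move: uv0; rewrite /quat_dot /= ur vr; lra.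
- by rewrite quat_dot_mul u1 v1 mulr1.
- by split; rewrite /quat_dot /= ur vr; ring.
Qed.

Lemma frame_mapK : cancel (frame_map u v) (frame_coord u v).
Proof.
have := frame_dots; rewrite /frame_map /frame_coord; move: (u * v) => k /=.
move=> [[ur vr kr] [uu vv kk uv [uk vk]]].
have dotE (a b c d : R) p : quat_dot (a *: 1 + b *: u + c *: v + d *: k) p =
  a * qre p + b * quat_dot u p + c * quat_dot v p + d * quat_dot k p.
  by rewrite /quat_dot /=; ring.
have dotC p q : quat_dot p q = quat_dot q p by rewrite /quat_dot; ring.
move=> q; apply: quat_eq; rewrite /= ?dotE ?ur ?vr ?kr; first ring.
- by rewrite uu (dotC v) uv (dotC k) uk; ring.
- by rewrite uv vv (dotC k) vk; ring.
- by rewrite uk vk kk; ring.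
Qed.

Lemma frame_map_inj : injective (frame_map u v).
Proof. exact: can_inj frame_mapK. Qed.

(** An injective endomorphism in finite dimension is bijective, so the left
    inverse is also a right inverse. *)
Lemma frame_coordK : cancel (frame_coord u v) (frame_map u v).
Proof.
move=> q.
have k0 : lker (linfun (frame_map u v)) == 0%VS.
  by apply/lker0P => x y; rewrite !lfunE; apply: frame_map_inj.
have <- := lker0_lfunVK k0 q.
by rewrite lfunE /= frame_mapK.
Qed.

Lemma frame_map_dot p q :
  quat_dot (frame_map u v p) (frame_map u v q) = quat_dot p q.
Proof.
have := frame_dots; rewrite /frame_map; move: (u * v) => k /=.
move=> [[ur vr kr] [uu vv kk uv [uk vk]]].
transitivity (qre p * qre q + qi p * qi q * quat_dot u u
  + qj p * qj q * quat_dot v v + qk p * qk q * quat_dot k k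
  + (qre p * qi q + qi p * qre q) * qre u
  + (qre p * qj q + qj p * qre q) * qre v
  + (qre p * qk q + qk p * qre q) * qre k
  + (qi p * qj q + qj p * qi q) * quat_dot u v
  + (qi p * qk q + qk p * qi q) * quat_dot u k
  + (qj p * qk q + qk p * qj q) * quat_dot v k).
  by rewrite /quat_dot /=; ring.
by rewrite uu vv kk ur vr kr uv uk vk /quat_dot; ring.
Qed.

Lemma frame_map_re q : qre (frame_map u v q) = qre q.
Proof.
have [[ur vr kr] _] := frame_dots.
by rewrite /frame_map /= in kr *; rewrite kr ur vr; ring.
Qed.

Lemma frame_mapV q : frame_map u v q^-1 = (frame_map u v q)^-1.
Proof.
have [->|q0] := eqVneq q 0; first by rewrite invr0 linear0 invr0.
have Eq0 : frame_map u v q \is a GRing.unit.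
  by apply: quat_neq0_unit; rewrite -quat_dot_eq0 frame_map_dot quat_dot_eq0.
by apply: (mulrI Eq0); rewrite -frame_mapM !divrr ?frame_map1.
Qed.

Lemma frame_preimage G : subgroup_S3 G -> subgroup_S3 (frame_map u v @^-1` G).
Proof.
move=> Gsub; split.
- by move=> q /(S3_unit Gsub); rewrite frame_map_dot => /unit_quatsE.
- by rewrite /preimage /= frame_map1; exact: S3_1.
- by move=> p q; rewrite !in_setE /preimage /= frame_mapM; exact: S3_M.
- by move=> q; rewrite !in_setE /preimage /= frame_mapV; exact: S3_V.
Qed.

Lemma frame_image G : subgroup_S3 G -> subgroup_S3 (frame_map u v @` G).
Proof.
move=> Gsub; split.
- move=> _ [q /(S3_unit Gsub) q1 <-].
  by apply/unit_quatsE; rewrite frame_map_dot.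
- by exists 1; [exact: S3_1|exact: frame_map1].
- move=> _ _ /set_mem[p Gp <-] /set_mem[q Gq <-].
  by exists (p * q); [exact: S3_M|exact: frame_mapM].
- move=> _ /set_mem[q Gq <-].
  by exists q^-1; [exact: S3_V|exact: frame_mapV].
Qed.

(** This transports the binary groups, which are given by generators, from the
    standard frame to any other. *)
Lemma frame_map_gen A : A `<=` @unit_quats R ->
  frame_map u v @` gen_S3 A = gen_S3 (frame_map u v @` A).
Proof.
move=> Aunit; apply/seteqP; split=> [_ [q gq <-] S [Ssub AS]|].
  apply: (gq (frame_map u v @^-1` S)); split; first exact: frame_preimage.
  by move=> a Aa; apply: AS; exists a.
apply: gen_S3_sub; first exact/frame_image/subgroup_S3_gen.
by apply: image_subset; exact: sub_gen_S3.
Qed.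

End Frame.

(** In the plane of [i] and [j], turn the projection of [u] by a right angle
    and normalize it; if this projection vanishes then [i] will do. *)
Lemma frame_extend u : imag_units u -> exists v, frame u v.
Proof.
move=> hu; have /imag_unitsE[u0 u1] := hu; move: u0 u1.
case: (u) hu => a x y z hu; rewrite /quat_dot /= => a0 u1.
have [xy0|xy0] := eqVneq (x ^+ 2 + y ^+ 2) 0.
  exists quat_i; split=> //; first by case: frame_std.
  have x0 : x = 0.
    apply/eqP; rewrite -sqrf_eq0 eq_le sqr_ge0 andbT.
    by have := sqr_ge0 y; lra.
  by rewrite /quat_dot /= a0 x0; ring.
set r := Num.sqrt (x ^+ 2 + y ^+ 2).
have r2 : r ^+ 2 = x ^+ 2 + y ^+ 2 by rewrite sqr_sqrtr ?addr_ge0 ?sqr_ge0.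
have r0 : r != 0 by rewrite -sqrf_eq0 r2.
exists (Quat 0 (- y / r) (x / r) 0); split=> //.
  apply/imag_unitsE; split=> //; rewrite /quat_dot /=.
  transitivity ((x ^+ 2 + y ^+ 2) / r ^+ 2); first by field.
  by rewrite r2 divff.
by rewrite /quat_dot /=; field.
Qed.

(** * Groups with integral traces that contain i and j *)

Section Signs.
Variables (S : set H) (Ssub : subgroup_S3 S).

(** The quaternion conjugate, which is the inverse, changes the sign of the
    second coordinate; combining it with [-1] changes that of the first one. *)
Lemma S3_signs_plane a b a' b' : S (-1) -> a' ^+ 2 = a ^+ 2 ->
  b' ^+ 2 = b ^+ 2 -> S (Quat a b 0 0) -> S (Quat a' b' 0 0).
Proof.
move=> SN1 /eqP ea /eqP eb Sab.
have flip x y : S (Quat x y 0 0) -> S (Quat x (- y) 0 0).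
  by move=> /(S3_conj Ssub); congr S; apply: quat_eq => /=; ring.
have neg x y : S (Quat x y 0 0) -> S (Quat (- x) y 0 0).
  by move=> /flip /(S3_M Ssub SN1); congr S; apply: quat_eq => /=; ring.
by move: ea eb; rewrite !eqf_sqr => /orP[]/eqP-> /orP[]/eqP->; auto.
Qed.

(** Conjugating by [i] or by [j] changes the signs of two imaginary coordinates,
    taking the inverse changes those of all three; so each imaginary sign can
    be changed alone.  The inverse and [i * i = -1] give the real sign. *)
Lemma S3_signs a b c d a' b' c' d' : S quat_i -> S quat_j ->
    a' ^+ 2 = a ^+ 2 -> b' ^+ 2 = b ^+ 2 -> c' ^+ 2 = c ^+ 2 ->
    d' ^+ 2 = d ^+ 2 ->
  S (Quat a b c d) -> S (Quat a' b' c' d').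
Proof.
move=> Si Sj /eqP ea /eqP eb /eqP ec /eqP ed Sh.
have flip2 x y z t : S (Quat x y z t) -> S (Quat x y (- z) (- t)).
  move=> Sx; have := S3_M Ssub (S3_M Ssub Si Sx) (S3_conj Ssub Si).
  by congr S; apply: quat_eq => /=; ring.
have flip3 x y z t : S (Quat x y z t) -> S (Quat x (- y) z (- t)).
  move=> Sx; have := S3_M Ssub (S3_M Ssub Sj Sx) (S3_conj Ssub Sj).
  by congr S; apply: quat_eq => /=; ring.
have flip x y z t : S (Quat x y z t) -> S (Quat x (- y) (- z) (- t)).
  exact: (S3_conj Ssub).
have flip1 x y z t : S (Quat x y z t) -> S (Quat (- x) y z t).
  move=> /flip Sx; have := S3_M Ssub (S3_M Ssub Si Si) Sx.
  by congr S; apply: quat_eq => /=; ring.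
have fi x y z t : S (Quat x y z t) -> S (Quat x (- y) z t).
  by move=> /flip /flip2; rewrite !opprK.
have fk x y z t : S (Quat x y z t) -> S (Quat x y z (- t)).
  by move=> /flip3 /fi; rewrite !opprK.
have fj x y z t : S (Quat x y z t) -> S (Quat x y (- z) t).
  by move=> /flip2 /fk; rewrite !opprK.
by move: ea eb ec ed; rewrite !eqf_sqr
  => /orP[]/eqP-> /orP[]/eqP-> /orP[]/eqP-> /orP[]/eqP->; auto 7.
Qed.

End Signs.

(** [2 * qre g] is the trace of [g], as the sum of [g] and its conjugate. *)
Definition integral_trace G :=
  forall g, G g -> exists n : int, 2 * qre g = n%:~R.

(** The squares of 0, [+-1/2] and [+-1]: squares rather than values are recorded
    because [S3_signs] absorbs the signs. *)
Lemma half_int_sqr (a : R) (n : int) : 2 * a = n%:~R -> a ^+ 2 <= 1 ->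
  [\/ a ^+ 2 = 0, a ^+ 2 = 1 / 4 | a ^+ 2 = 1].
Proof.
move=> an a1; have sq : 4 * a ^+ 2 = (n ^+ 2)%:~R :> R.
  by rewrite rmorphXn /= -an; ring.
have : n ^+ 2 <= 4.
  by rewrite -(ler_int R) -sq; lra.
move=> n4; have [n0|n0] := eqVneq n 0.
  by apply: Or31; move: sq; rewrite n0; lra.
have n1 : 0 < `|n| by rewrite normr_gt0.
have [n2|n2] : `|n| = 1 \/ `|n| = 2.
- by rewrite -(real_normK (num_real n)) expr2 in n4; nia.
- by apply: Or32; move: sq; rewrite -(real_normK (num_real n)) n2 => sq; lra.
- by apply: Or33; move: sq; rewrite -(real_normK (num_real n)) n2 => sq; lra.
Qed.

Section Quaternionic.
Variables (G : set H) (Gsub : subgroup_S3 G) (Gint : integral_trace G).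
Hypotheses (GI : G quat_i) (GJ : G quat_j).

(** The coordinates of [h] are the real parts of [h], [h i^-1], [h j^-1] and
    [h k^-1], all of which are in [G]. *)
Lemma hurwitz_coord a b c d : G (Quat a b c d) ->
  let sq x := [\/ x ^+ 2 = 0, x ^+ 2 = 1 / 4 | x ^+ 2 = 1] in
  [/\ sq a, sq b, sq c & sq d].
Proof.
move=> Gh; have := S3_unit Gsub Gh; rewrite /quat_dot /= -!expr2 => h1.
have := (sqr_ge0 a, sqr_ge0 b, sqr_ge0 c, sqr_ge0 d).
move=> [[[a0 b0] c0] d0].
have GK := S3_M Gsub GI GJ.
have [na ea] := Gint Gh.
have [nb eb] := Gint (S3_M Gsub Gh (S3_conj Gsub GI)).
have [nc ec] := Gint (S3_M Gsub Gh (S3_conj Gsub GJ)).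
have [nd ed] := Gint (S3_M Gsub Gh (S3_conj Gsub GK)).
split; [apply: (half_int_sqr (n := na))|apply: (half_int_sqr (n := nb))
  |apply: (half_int_sqr (n := nc))|apply: (half_int_sqr (n := nd))];
  by [lra | rewrite -?ea -?eb -?ec -?ed /=; ring].
Qed.

(** Four squares out of 0, 1/4, 1 with sum 1 are either 1, 0, 0, 0 in some order
    or all equal to 1/4.  In the first case the element is, up to sign, one of
    [1, i, j, i * j]. *)
Lemma hurwitz_cases a b c d : G (Quat a b c d) ->
  (forall S, subgroup_S3 S -> S quat_i -> S quat_j -> S (Quat a b c d)) \/
  [/\ a ^+ 2 = (1 / 2) ^+ 2, b ^+ 2 = (1 / 2) ^+ 2, c ^+ 2 = (1 / 2) ^+ 2
    & d ^+ 2 = (1 / 2) ^+ 2].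
Proof.
move=> Gh; have := S3_unit Gsub Gh; rewrite /quat_dot /= -!expr2 => h1.
have [[ea|ea|ea] [eb|eb|eb] [ec|ec|ec] [ed|ed|ed]] := hurwitz_coord Gh;
  try (exfalso; lra);
  [left=> S Ssub Si Sj..|right|left=> S Ssub Si Sj].
- have Sk : S (Quat 0 0 0 1).
    by have := S3_M Ssub Si Sj; congr S; apply: quat_eq => /=; ring.
  by apply: S3_signs Sk => //; lra.
- by apply: (S3_signs Ssub) (Sj) => //; lra.
- by apply: (S3_signs Ssub) (Si) => //; lra.
- by split; lra.
- by apply: (S3_signs Ssub) (S3_1 Ssub) => //; lra.
Qed.

(** Conjugation by [(-1 + i + j + k) / 2] permutes [i, j, k] cyclically, hence
    the second generator of the quaternion group is obtained from the first. *)
Lemma bin_T_closed S : subgroup_S3 S -> S quat_i ->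
  S (2^-1 *: (-1 + quat_i + quat_j + quat_i * quat_j)) -> S quat_j.
Proof.
move=> Ssub Si St.
have Sk : S (quat_i * quat_j).
  have := S3_M Ssub (S3_M Ssub St Si) (S3_conj Ssub St).
  by congr S; apply: quat_eq => /=; field.
by have := S3_M Ssub Sk Si; congr S; apply: quat_eq => /=; ring.
Qed.

Lemma hurwitz_classification :
  G = bin_D4 quat_i quat_j \/ G = bin_T quat_i quat_j.
Proof.
have D4G : bin_D4 quat_i quat_j `<=` G by apply: gen_S3_sub => // q [|] ->.
have [[[a b c d] Gh [/= ea eb ec ed]]|noh] := pselect (exists2 h : H, G h &
  [/\ qre h ^+ 2 = (1 / 2) ^+ 2, qi h ^+ 2 = (1 / 2) ^+ 2,
      qj h ^+ 2 = (1 / 2) ^+ 2 & qk h ^+ 2 = (1 / 2) ^+ 2]).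
- right; set t : H := 2^-1 *: (-1 + quat_i + quat_j + quat_i * quat_j).
  have tE : t = Quat (- (1 / 2)) (1 / 2) (1 / 2) (1 / 2).
    by apply: quat_eq => /=; field.
  apply/seteqP; split=> [[a' b' c' d'] Gg S [Ssub AS]|].
    have [Si St] : S quat_i /\ S t by split; apply: AS; [left|right].
    have Sj := bin_T_closed Ssub Si St.
    have [|[ea' eb' ec' ed']] := hurwitz_cases Gg; first exact.
    by move: St; rewrite tE; apply: S3_signs; rewrite // ?sqrrN.
  apply: gen_S3_sub => // q [|] -> //.
  by rewrite -/t tE; apply: (S3_signs Gsub) Gh; rewrite // ?sqrrN.
- left; apply/seteqP; split=> // -[a b c d] Gg S [Ssub AS].
  have [|sq] := hurwitz_cases Gg; last by case: noh; exists (Quat a b c d).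
  by apply=> //; apply: AS; [left|right].
Qed.

End Quaternionic.

(** * Groups with integral traces and an element of order 6 *)

Lemma cos_pi3 : cos (pi / 3 : R) = 1 / 2.
Proof.
set t := pi / 3 : R; have tpi : t + (t + t) = pi by rewrite /t; field.
have pi0 := pi_gt0 R.
have c0 : 0 < cos t by apply: cos_gt0_pihalf; rewrite /t; lra.
have := cospi R; rewrite -tpi !(cosD, sinD) => e.
have s2 := sin2cos2 t.
(* The triple angle formula turns cos (3 t) = -1 into this equation. *)
have : (cos t + 1) * (2 * cos t - 1) ^+ 2 = 0.
  transitivity (cos t * (cos t * cos t - (1 - cos t ^+ 2)) -
    (2 * cos t) * (1 - cos t ^+ 2) + 1); first by ring.
  by rewrite -s2; have := e; rewrite expr2; lra.
move/eqP; rewrite mulf_eq0 sqrf_eq0 => /orP[]/eqP; lra.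
Qed.

Lemma sin_pi3_sqr : sin (pi / 3 : R) ^+ 2 = 3 / 4.
Proof. by rewrite sin2cos2 cos_pi3; field. Qed.

Lemma quat_exp_pi3I :
  quat_exp (pi / 3) quat_i = Quat (1 / 2) (sin (pi / 3)) 0 0.
Proof. by rewrite /quat_exp cos_pi3; apply: quat_eq => /=; ring. Qed.

(** [m^2 - m n + n^2] is the norm of an Eisenstein integer.  It never takes the
    value 2, and takes the value 3 only with [m] nonzero. *)
Lemma eisenstein_norm_le3 (m n : int) : m ^+ 2 - m * n + n ^+ 2 <= 3 ->
  [\/ m ^+ 2 - m * n + n ^+ 2 = 0, m ^+ 2 - m * n + n ^+ 2 = 1 |
      m ^+ 2 - m * n + n ^+ 2 = 3 /\ (m ^+ 2 = 1 \/ m ^+ 2 = 4)].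
Proof.
rewrite !expr2 => le3.
have mb : -2 <= m <= 2 by nia.
have nb : -2 <= n <= 2 by nia.
have small (k : int) : -2 <= k <= 2 ->
  k = -2 \/ k = -1 \/ k = 0 \/ k = 1 \/ k = 2 by lia.
by move: le3; case: (small _ mb) => [->|[->|[->|[->|->]]]];
  case: (small _ nb) => [->|[->|[->|[->|->]]]] // _;
  (try by apply: Or31); (try by apply: Or32);
  apply: Or33; split=> //; (try by left); right.
Qed.

Section Hexagonal.
Variables (G : set H) (Gsub : subgroup_S3 G) (Gint : integral_trace G).
Notation w := (quat_exp (pi / 3) quat_i).
Hypotheses (Gw : G w).
Hypothesis no_frame : ~ exists u v, [/\ frame u v, G u & G v].

(** With [m, n] twice the inner products of [h] with [1] and [w], one has
    [a^2 + b^2 = (m^2 - m n + n^2) / 3], which is at most 1 as [h] is a unit.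
    The values 0 and 1 are the two cases of the conclusion.  For the value 1/3
    write [h = P + Q] along the plane of [1, i] and its complement; then
    [w h w^-1 = P + w^2 Q], and the inner product with [h] is
    [1/3 + 2/3 * cos (2 pi / 3) = 0]. *)
Lemma hexagon_dichotomy a b c d : G (Quat a b c d) ->
  (a = 0 /\ b = 0) \/
  [/\ c = 0, d = 0
    & (a ^+ 2 = 1 / 4 /\ b ^+ 2 = 3 / 4) \/ (a ^+ 2 = 1 /\ b = 0)].
Proof.
move=> Gh; have h1 := S3_unit Gsub Gh.
rewrite /quat_dot /= -!expr2 in h1.
have s2 := sin_pi3_sqr.
have Gw' := Gw; rewrite quat_exp_pi3I in Gw'.
have [m em] := Gint Gh.
have [n en] := Gint (S3_M Gsub Gh (S3_conj Gsub Gw')).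
move: em en Gw'; rewrite /=; set s := sin _ in s2 * => em en Gw'.
have eQ : (m ^+ 2 - m * n + n ^+ 2)%:~R = 3 * (a ^+ 2 + b ^+ 2).
  rewrite rmorphD rmorphB !rmorphXn rmorphM /= -em -en.
  transitivity (3 * a ^+ 2 + 4 * s ^+ 2 * b ^+ 2); first by field.
  by rewrite s2; field.
have := (sqr_ge0 a, sqr_ge0 b, sqr_ge0 c, sqr_ge0 d).
move=> [[[a0 b0] c0] d0].
have [|e|e|[e em2]] := @eisenstein_norm_le3 m n.
- by rewrite -(ler_int R) eQ; lra.
- by left; split; apply: sqr_le0_eq0; rewrite e /= in eQ; lra.
- exfalso; apply: no_frame; rewrite e /= in eQ.
  (* The three vectors h, w h w^-1, w^2 h w^-2 are orthonormal, and multiplying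
     the last two on the right by h^-1 moves h to 1. *)
  pose h : H := Quat a b c d; pose w' : H := Quat (1 / 2) s 0 0.
  pose u := w' * h * quat_conj w' * quat_conj h.
  pose v := w' * w' * h * quat_conj w' * quat_conj w' * quat_conj h.
  exists u, v.
  have Gu : G u by repeat (apply: S3_M => //; try exact: S3_conj).
  have Gv : G v by repeat (apply: S3_M => //; try exact: S3_conj).
  have cd : c ^+ 2 + d ^+ 2 = 2 / 3 by lra.
  have ab : a ^+ 2 + b ^+ 2 = 1 / 3 by lra.
  split=> //; split.
  + apply/imag_unitsE; split; last exact: S3_unit Gu.
    transitivity ((a ^+ 2 + b ^+ 2) * ((1 / 2) ^+ 2 + s ^+ 2)
      + (c ^+ 2 + d ^+ 2) * ((1 / 2) ^+ 2 - s ^+ 2)).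
      by rewrite /=; ring.
    by rewrite ab cd s2; field.
  + apply/imag_unitsE; split; last exact: S3_unit Gv.
    transitivity ((a ^+ 2 + b ^+ 2) * ((1 / 2) ^+ 2 + s ^+ 2) ^+ 2 +
     (c ^+ 2 + d ^+ 2) * (((1 / 2) ^+ 2 - s ^+ 2)^+ 2 - s ^+ 2)).
      by rewrite /=; field.
    by rewrite ab cd s2; field.
  + transitivity (quat_dot h h * ((1 / 2) ^+ 2 + s ^+ 2) ^+ 2 *
      ((a ^+ 2 + b ^+ 2) * ((1 / 2) ^+ 2 + s ^+ 2) +
       (c ^+ 2 + d ^+ 2) * ((1 / 2) ^+ 2 - s ^+ 2))).
      by rewrite /quat_dot /=; field.
    by rewrite ab cd s2; field.
- right; rewrite e /= in eQ.
  have m2 : 4 * a ^+ 2 = (m ^+ 2)%:~R by rewrite rmorphXn /= -em; ring.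
  split; [apply: sqr_le0_eq0; lra|apply: sqr_le0_eq0; lra|].
  by case: em2 => em2; rewrite em2 /= in m2; [left|right]; split;
    try apply: sqr_le0_eq0; lra.
Qed.

(** In the plane of [1] and [i] there remain [+-1] and the four elements
    [+-1/2 +- s i] with [s = sin (pi / 3)]: these are the powers of [w]. *)
Lemma plane_in_gen a b S : subgroup_S3 S -> S w -> G (Quat a b 0 0) ->
  a != 0 -> S (Quat a b 0 0).
Proof.
move=> Ssub; rewrite quat_exp_pi3I => Sw Gh a0.
have s2 := sin_pi3_sqr; move: s2 Sw; set s := sin _ => s2 Sw.
have SN1 : S (-1).
  have := S3_M Ssub (S3_M Ssub Sw Sw) Sw; congr S.
  have -> : Quat (1 / 2) s 0 0 * Quat (1 / 2) s 0 0 = Quat (- (1 / 2)) s 0 0.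
    by apply: quat_eq => /=; [lra|field|ring..].
  by apply: quat_eq => /=; [lra|field|ring..].
have [[az _]|[_ _ [[a2 b2]|[a2 bz]]]] := hexagon_dichotomy Gh.
- by rewrite az eqxx in a0.
- by apply: (S3_signs_plane Ssub SN1) Sw; rewrite ?s2 ?a2 ?b2; field.
- by apply: (S3_signs_plane Ssub SN1) (S3_1 Ssub); rewrite ?a2 ?bz; ring.
Qed.

Lemma hexagonal_classification :
  G = bin_C3 quat_i \/ exists c d, G (Quat 0 0 c d).
Proof.
have [[c [d Gcd]]|nocd] := pselect (exists c d, G (Quat 0 0 c d)).
  by right; exists c, d.
left; apply/seteqP; split; last by apply: gen_S3_sub => // _ ->.
move=> [a b c d] Gh S [Ssub AS].
have [[a0 b0]|[c0 d0 ab]] := hexagon_dichotomy Gh.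
  by case: nocd; exists c, d; move: Gh; rewrite a0 b0.
move: Gh; rewrite c0 d0 => Gh; apply: plane_in_gen => //; first exact: AS.
by case: ab => -[a2 _]; apply/eqP => a0; move: a2; rewrite a0; lra.
Qed.

(** An element orthogonal to the plane of [1] and [i] falls into it after
    multiplication by [j^-1], so [G] is the union of [<w>] and [<w> j]. *)
Lemma hexagonal_classificationJ : G quat_j -> G = bin_D6 quat_i quat_j.
Proof.
move=> GJ; apply/seteqP; split; last by apply: gen_S3_sub => // _ [|] ->.
move=> [a b c d] Gh S [Ssub AS].
have [Sw Sj] : S w /\ S quat_j by split; apply: AS; [left|right].
have inplane x y : G (Quat x y 0 0) -> S (Quat x y 0 0).
  move=> Gxy; apply: plane_in_gen => //; apply/eqP => x0.
  have [[_ y0]|[_ _ ab]] := hexagon_dichotomy Gxy.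
    by have := S3_unit Gsub Gxy; rewrite /quat_dot /= x0 y0; lra.
  by case: ab => -[a2 _]; move: a2; rewrite x0; lra.
have [[a0 b0]|[c0 d0 _]] := hexagon_dichotomy Gh; last first.
  by move: Gh; rewrite c0 d0; exact: inplane.
have /inplane : G (Quat c d 0 0).
  have := S3_M Gsub Gh (S3_conj Gsub GJ); congr G.
  by apply: quat_eq; rewrite /= ?a0 ?b0; ring.
move=> /(S3_M Ssub)/(_ Sj); congr S.
by apply: quat_eq; rewrite /= ?a0 ?b0; ring.
Qed.

End Hexagonal.

(** * The binary groups of a frame *)

Definition exceptional u v G :=
  G = bin_C3 u \/ G = bin_C2 u \/ G = bin_D4 u v \/ G = bin_D6 u v \/
  G = bin_T u v.

Lemma frame_map_exp u v t : frame_map u v (quat_exp t quat_i) = quat_exp t u.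
Proof. by rewrite /quat_exp linearD !linearZ /= frame_map1 frame_mapI. Qed.

Lemma frame_mapT u v : frame u v ->
  frame_map u v (2^-1 *: (-1 + quat_i + quat_j + quat_i * quat_j)) =
  2^-1 *: (-1 + u + v + u * v).
Proof.
move=> fuv; rewrite linearZ !linearD linearN /= frame_mapM // frame_map1.
by rewrite frame_mapI frame_mapJ !scalerDr.
Qed.

Lemma unit_quats_exp u t : imag_units u -> unit_quats (quat_exp t u).
Proof.
move=> /imag_unitsE[u0]; case: u u0 => a b c d /= ->.
rewrite /quat_dot /= => u1.
apply/unit_quatsE; rewrite /quat_dot /quat_exp /=.
transitivity (cos t ^+ 2 + sin t ^+ 2 * (0 * 0 + b * b + c * c + d * d)).
  by ring.
by rewrite u1 mulr1 cos2Dsin2.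
Qed.

Lemma unit_quats_bin_T u v : frame u v ->
  unit_quats (2^-1 *: (-1 + u + v + u * v)).
Proof.
move=> fuv; apply/unit_quatsE; rewrite -frame_mapT // frame_map_dot //.
by rewrite /quat_dot /=; field.
Qed.

Lemma frame_exceptional u v B : frame u v ->
  exceptional quat_i quat_j B -> exceptional u v (frame_map u v @` B).
Proof.
move=> fuv; have [fI fJ _] := frame_std.
have uI : unit_quats quat_i by apply/unit_quatsE; case/imag_unitsE: fI.
have uJ : unit_quats quat_j by apply/unit_quatsE; case/imag_unitsE: fJ.
have uw := unit_quats_exp (pi / 3) fI.
have uT := unit_quats_bin_T frame_std.
have gen2 (x y : H) : unit_quats x -> unit_quats y ->
  frame_map u v @` gen_S3 [set x; y] =
  gen_S3 [set frame_map u v x; frame_map u v y].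
  by move=> ux uy; rewrite frame_map_gen ?image_setU ?image_set1 // => _ [] ->.
have gen1 (x : H) : unit_quats x ->
  frame_map u v @` gen_S3 [set x] = gen_S3 [set frame_map u v x].
  by move=> ux; rewrite frame_map_gen ?image_set1 // => _ ->.
rewrite /exceptional /bin_C3 /bin_C2 /bin_D4 /bin_D6 /bin_T.
move=> [|[|[|[|]]]] ->; rewrite ?gen1 ?gen2 // ?frame_mapT ?frame_map_exp
  ?frame_mapI ?frame_mapJ; tauto.
Qed.

(** The first generator, [I] or [exp (pi I / 3)], has order 4 or 6. *)
Lemma exceptional_not_involutive I J G : frame I J -> exceptional I J G ->
  subgroup_S3 G /\ exists2 g, G g & g * g <> 1.
Proof.
move=> fIJ exG; have [hI hJ _] := fIJ.
have uI : unit_quats I by apply/unit_quatsE; case/imag_unitsE: hI.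
have uJ : unit_quats J by apply/unit_quatsE; case/imag_unitsE: hJ.
have uw := unit_quats_exp (pi / 3) hI.
have uT := unit_quats_bin_T fIJ.
have II : I * I <> 1.
  rewrite -expr2 hI => /(congr1 (@qre R)) /=; lra.
have ww : quat_exp (pi / 3) I * quat_exp (pi / 3) I <> 1.
  rewrite -(frame_map_exp I J) -frame_mapM // quat_exp_pi3I.
  move=> /(congr1 (@qre R)); rewrite frame_map_re //=.
  by have := sin_pi3_sqr; rewrite expr2; lra.
have gen2 (x y : H) : unit_quats x -> unit_quats y -> x * x <> 1 ->
    subgroup_S3 (gen_S3 [set x; y]) /\
    exists2 g, gen_S3 [set x; y] g & g * g <> 1.
  move=> ux uy xx; split; first by apply: subgroup_S3_gen => _ [] ->.
  by exists x => //; apply: sub_gen_S3; left.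
have gen1 (x : H) : unit_quats x -> x * x <> 1 ->
    subgroup_S3 (gen_S3 [set x]) /\ exists2 g, gen_S3 [set x] g & g * g <> 1.
  move=> ux xx; split; first by apply: subgroup_S3_gen => _ ->.
  by exists x => //; apply: sub_gen_S3.
by move: exG => [|[|[|[|]]]] ->; [apply: gen1|apply: gen1|apply: gen2..].
Qed.

(** * The classification of groups with integral traces *)

(** For [h] in [G], the real parts of [h] and of [h i^-1], that is the first two
    coordinates of [h], are in [{0, 1, -1}].  If both vanish then [i] and [h]
    form a frame. *)
Lemma cyclic4_classification G : subgroup_S3 G -> integral_trace G ->
    G quat_i -> ~ (exists u v, [/\ frame u v, G u & G v]) ->
    (forall g, G g -> 2 * qre g <> 1) ->
  G = bin_C2 quat_i.
Proof.
move=> Gsub Gint GI no_frame no_hex.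
apply/seteqP; split; last by apply: gen_S3_sub => // _ ->.
have no_half g : G g -> qre g ^+ 2 <> 1 / 4.
  move=> Gg g2; have := no_hex _ Gg.
  have := no_hex _ (S3_M Gsub (S3_M Gsub GI GI) Gg).
  have : (2 * qre g - 1) * (2 * qre g + 1) = 0.
    by transitivity (4 * qre g ^+ 2 - 1); [ring|rewrite g2; field].
  by move=> /eqP; rewrite mulf_eq0 => /orP[]/eqP g1 /=; lra.
have SN1 S : subgroup_S3 S -> S quat_i -> S (-1).
  move=> Ssub Si; have := S3_M Ssub Si Si; congr S.
  by apply: quat_eq => /=; ring.
move=> [a b c d] Gh S [Ssub AS]; have Si : S quat_i by exact: AS.
have h1 := S3_unit Gsub Gh; rewrite /quat_dot /= -!expr2 in h1.
have := (sqr_ge0 a, sqr_ge0 b, sqr_ge0 c, sqr_ge0 d).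
move=> [[[a0 b0] c0] d0].
have Gg := S3_M Gsub Gh (S3_conj Gsub GI).
have [m em] := Gint _ Gh; have [n] := Gint _ Gg.
have := no_half _ Gg.
have -> : qre (Quat a b c d * quat_conj quat_i) = b by rewrite /=; ring.
move=> b4 en; have a4 := no_half _ Gh; rewrite /= in a4 em.
have [|a2|//|a2] := half_int_sqr em; first lra; last first.
  have -> : c = 0 by apply: sqr_le0_eq0; lra.
  have -> : d = 0 by apply: sqr_le0_eq0; lra.
  apply: (S3_signs_plane Ssub (SN1 _ Ssub Si)) (S3_1 Ssub); lra.
have [|b2|//|b2] := half_int_sqr en; first lra; last first.
  have -> : c = 0 by apply: sqr_le0_eq0; lra.
  have -> : d = 0 by apply: sqr_le0_eq0; lra.
  apply: (S3_signs_plane Ssub (SN1 _ Ssub Si)) (Si); lra.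
case: no_frame; exists quat_i, (Quat a b c d); split=> //.
have [fI _ _] := frame_std; split=> //.
  apply/imag_unitsE; split; last exact: S3_unit Gh.
  by rewrite /= (sqr_le0_eq0 (x := a)) ?a2 //.
by rewrite /quat_dot /= (sqr_le0_eq0 (x := b)) ?b2 //; ring.
Qed.

(** The group is presented as the image of a standard group [B] and not as one
    of the groups [bin_C2 u], ..., since [B] is what the frame map of another
    pair [I, J] has to be applied to. *)
Theorem integral_trace_classification G :
    subgroup_S3 G -> integral_trace G -> G (-1) ->
    (exists g, [/\ G g, g != 1 & g != -1]) ->
  exists u v B,
    [/\ frame u v, G = frame_map u v @` B & exceptional quat_i quat_j B].
Proof.
move=> Gsub Gint GN1 [g [Gg g1 gN1]].
have split_frame u v : frame u v ->
    exceptional quat_i quat_j (frame_map u v @^-1` G) ->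
    exists u v B,
      [/\ frame u v, G = frame_map u v @` B & exceptional quat_i quat_j B].
  move=> fuv ex; exists u, v, (frame_map u v @^-1` G); split=> //.
  rewrite image_preimage //; apply/seteqP; split=> // q _.
  by exists (frame_coord u v q) => //; exact: frame_coordK.
have preint u v : frame u v -> integral_trace (frame_map u v @^-1` G).
  by move=> fuv q /Gint[n]; rewrite frame_map_re // => qn; exists n.
have presub u v (fuv : frame u v) := frame_preimage fuv Gsub.
have [[u [v [fuv Gu Gv]]]|no_frame] :=
  pselect (exists u v, [/\ frame u v, G u & G v]).
  apply: (split_frame _ _ fuv).
  have Gi : (frame_map u v @^-1` G) quat_i by rewrite /preimage /= frame_mapI.
  have Gj : (frame_map u v @^-1` G) quat_j by rewrite /preimage /= frame_mapJ.
  have := hurwitz_classification (presub _ _ fuv) (preint _ _ fuv) Gi Gj.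
  by rewrite /exceptional; tauto.
have no_preframe u v : frame u v ->
    ~ exists p q, [/\ frame p q, (frame_map u v @^-1` G) p
                    & (frame_map u v @^-1` G) q].
  move=> fuv [p [q [[/imag_unitsE[p0 p1] /imag_unitsE[q0 q1] pq] Gp Gq]]].
  apply: no_frame; exists (frame_map u v p), (frame_map u v q).
  by split=> //; split; rewrite ?frame_map_dot //; apply/imag_unitsE;
    rewrite frame_map_re // frame_map_dot.
have [[w Gw w1]|no_hex] := pselect (exists2 w, G w & 2 * qre w = 1).
  have s0 : 0 < sin (pi / 3 : R).
    by apply: sin_gt0_pi; have := pi_gt0 R; lra.
  have s2 := sin_pi3_sqr.
  pose u : H := (sin (pi / 3))^-1 *: (w - (1 / 2) *: 1).
  have wE : w = quat_exp (pi / 3) u.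
    rewrite /quat_exp /u scalerA divff ?gt_eqF // scale1r cos_pi3.
    by rewrite addrC subrK.
  have hu : imag_units u.
    apply/imag_unitsE; split.
      by rewrite /u /= (_ : qre w = 1 / 2); [ring|lra].
    have := S3_unit Gsub Gw.
    rewrite (_ : quat_dot w w = qre w ^+ 2 + sin (pi / 3) ^+ 2 * quat_dot u u).
      rewrite s2 (_ : qre w = 1 / 2); last lra.
      by lra.
    rewrite /u /quat_dot /= (_ : qre w = 1 / 2); last lra.
    by field; rewrite gt_eqF.
  (* The second vector v of the frame is arbitrary here: it serves only to have
     coordinates.  If G has an element orthogonal to 1 and u, that element
     replaces v. *)
  have [v fuv] := frame_extend hu.
  have Gpw v' : (frame_map u v' @^-1` G) (quat_exp (pi / 3) quat_i).
    by rewrite /preimage /= frame_map_exp -wE.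
  have [C3|[c [d]]] := hexagonal_classification (presub _ _ fuv)
    (preint _ _ fuv) (Gpw v) (no_preframe _ _ fuv).
    by apply: (split_frame _ _ fuv); left.
  rewrite /preimage /=; set v' := frame_map _ _ _ => Gv'.
  have fuv' : frame u v'.
    split=> //.
      apply/imag_unitsE; rewrite frame_map_re //.
      by split; last exact: S3_unit Gv'.
    by rewrite -{1}(frame_mapI u v) frame_map_dot // /quat_dot /=; ring.
  apply: (split_frame _ _ fuv'); rewrite /exceptional.
  rewrite -(hexagonal_classificationJ (presub _ _ fuv')
    (preint _ _ fuv') (Gpw v') (no_preframe _ _ fuv')); first tauto.
  by rewrite /preimage /= frame_mapJ.
have g0 : qre g = 0.
  have h1 := S3_unit Gsub Gg; rewrite /quat_dot /= -!expr2 in h1.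
  have := (sqr_ge0 (qi g), sqr_ge0 (qj g), sqr_ge0 (qk g)).
  move=> [[b0 c0] d0].
  have [n en] := Gint _ Gg.
  have [|g2|g2|g2] := half_int_sqr en; first lra.
  + by apply: sqr_le0_eq0; rewrite g2.
  + exfalso; have : (2 * qre g - 1) * (2 * qre g + 1) = 0.
      by transitivity (4 * qre g ^+ 2 - 1); [ring|rewrite g2; field].
    move=> /eqP; rewrite mulf_eq0 => /orP[]/eqP ge; apply: no_hex.
      by exists g => //; lra.
    by exists (-1 * g); [exact: S3_M|rewrite /=; lra].
  + exfalso; move/eqP: g2; rewrite sqrf_eq1 => /orP[]/eqP ge.
      by case/eqP: g1; apply: quat_eq => //=; apply: sqr_le0_eq0;
        move: h1; rewrite ge; lra.
    by case/eqP: gN1; apply: quat_eq => //=; rewrite oppr0; apply: sqr_le0_eq0;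
      move: h1; rewrite ge; lra.
have hg : imag_units g by apply/imag_unitsE; split=> //; exact: S3_unit Gg.
have [v fgv] := frame_extend hg.
apply: (split_frame _ _ fgv).
right; left; apply: cyclic4_classification (presub _ _ fgv) (preint _ _ fgv)
  _ (no_preframe _ _ fgv) _.
  by rewrite /preimage /= frame_mapI.
move=> h Gh h2; apply: no_hex; exists (frame_map g v h) => //.
by rewrite frame_map_re.
Qed.

(** * The stabilizer of a lattice *)

Definition lattice_stabilizer L : set H :=
  [set a | unit_quats a /\ (fun q => q * a) @` L = L].

Section Lattice.
Variables (L : set H) (hL : lattice4 L).

Lemma lattice0 : L 0.
Proof.
case: hL => v _ ->; exists 0; rewrite big1 // => i _; rewrite ffunE mulr0z //.
Qed.

Lemma latticeB p q : L p -> L q -> L (p - q).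
Proof.
case: hL => v _ -> [a ->] [b ->]; exists (a - b).
rewrite -sumrB; apply: eq_bigr => i _.
by rewrite !ffunE mulrzBr.
Qed.

Lemma latticeN p : L p -> L (- p).
Proof.
by move=> Lp; rewrite -sub0r; apply: latticeB => //; exact: lattice0.
Qed.

Lemma latticeD p q : L p -> L q -> L (p + q).
Proof. by move=> Lp Lq; rewrite -[q]opprK; apply/latticeB/latticeN. Qed.

(** The vector [x] may be any element of a basis of [L]: the coordinate along
    [x] of an element of [L] is an integer. *)
Lemma lattice_scaling_int : exists2 x, L x &
  forall t : R, L (t *: x) -> exists n : int, t = n%:~R.
Proof.
have [v vfree LE] := hL.
exists v`_0.
  rewrite LE; exists [ffun i : 'I_4 => (i == ord0)%:R : int].
  rewrite (bigD1 ord0) //= ffunE eqxx big1 ?addr0 // => i i0.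
  by rewrite ffunE (negPf i0) mulr0z.
move=> t; rewrite LE => -[n tn]; exists (n ord0).
have := congr1 (coord v ord0) tn.
rewrite linearZ /= (coord_free ord0 ord0 vfree) eqxx mulr1 => ->.
rewrite linear_sum (bigD1 ord0) //= big1 ?addr0 => [|i i0].
  by rewrite -scaler_int linearZ /= (coord_free ord0 ord0 vfree) eqxx mulr1.
rewrite -scaler_int linearZ /= (coord_free i ord0 vfree).
by rewrite [_ == _](negPf i0) mulr0.
Qed.

Lemma stabilizer_subgroup : subgroup_S3 (lattice_stabilizer L).
Proof.
split=> [a []//| | |].
- split; first exact: S3_1 subgroup_S3_unit_quats.
  rewrite (_ : (fun q : H => q * 1) = id) ?image_id //.
  by apply/funext => q; rewrite mulr1.
- move=> a b /set_mem[a1 La] /set_mem[b1 Lb]; split.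
    exact: S3_M subgroup_S3_unit_quats _ _ a1 b1.
  rewrite -[in RHS]Lb -[in RHS]La image_comp.
  by congr (_ @` _); apply/funext => q /=; rewrite mulrA.
- move=> a /set_mem[a1 La]; split.
    exact: S3_V subgroup_S3_unit_quats _ a1.
  have ua := unit_quat_unit (iffLR (unit_quatsE a) a1).
  rewrite -[in LHS]La image_comp -[RHS]image_id.
  by congr (_ @` _); apply/funext => q /=; rewrite mulrK.
Qed.

Lemma stabilizer_act a q : lattice_stabilizer L a -> L q -> L (q * a).
Proof. by move=> [_ La] Lq; rewrite -La; exists q. Qed.

(** Crystallographic restriction: [(2 * Re a) *: x = x * a + x * a^-1]. *)
Lemma stabilizer_int : integral_trace (lattice_stabilizer L).
Proof.
move=> a Ga; have [x Lx xint] := lattice_scaling_int; apply: xint.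
have Ga' := S3_conj stabilizer_subgroup Ga.
rewrite (_ : _ *: x = x * a + x * quat_conj a).
  by apply: latticeD; exact: stabilizer_act.
by apply: quat_eq => /=; ring.
Qed.

Lemma stabilizerN1 : lattice_stabilizer L (-1).
Proof.
split; first by apply/unit_quatsE; rewrite /quat_dot /=; ring.
apply/seteqP; split=> [_ [q Lq <-]|q Lq].
  by rewrite mulrN1; exact: latticeN.
by exists (- q); [exact: latticeN|rewrite mulrN1 opprK].
Qed.

Lemma Aut_torusE : Aut_torus L = (fun a q => q * a) @` lattice_stabilizer L.
Proof.
apply/seteqP; split=> [F [a a1 [-> La]]|_ [a [a1 La] <-]]; first by exists a.
by exists a.
Qed.

(** [F] is right multiplication by [F 1], and composition reverses the order of
    these factors; the inverse in [f] restores it. *)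
Lemma Aut_isog_frame u v I J B : frame u v -> frame I J ->
    lattice_stabilizer L = frame_map u v @` B ->
  Aut_isog L (frame_map I J @` B).
Proof.
move=> fuv fIJ GE.
pose f (F : H -> H) := frame_map I J (frame_coord u v (F 1)^-1).
have Bsub : subgroup_S3 B.
  rewrite (_ : B = frame_map u v @^-1` (lattice_stabilizer L)).
    by apply: frame_preimage => //; exact: stabilizer_subgroup.
  rewrite GE; apply/seteqP; split=> [b Bb|b [b' Bb'] /(frame_map_inj fuv)<- //].
  by exists b.
have fE b : f (fun q => q * frame_map u v b) = frame_map I J b^-1.
  by rewrite /f mul1r -frame_mapV // frame_mapK.
have AutE F : Aut_torus L F <->
    exists2 b, B b & F = (fun q => q * frame_map u v b).
  rewrite Aut_torusE GE; split=> [[_ [b Bb <-] <-]|[b Bb ->]].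
    by exists b.
  by exists (frame_map u v b) => //; exists b.
exists f; first split.
- by move=> F /AutE[b Bb ->]; rewrite fE; exists b^-1 => //; exact: S3_V.
- move=> F F' /set_mem/AutE[b Bb ->] /set_mem/AutE[b' Bb' ->].
  by rewrite !fE => /(frame_map_inj fIJ)/invr_inj->.
- move=> _ [b Bb <-]; exists (fun q => q * frame_map u v b^-1).
    by apply/AutE; exists b^-1 => //; exact: S3_V.
  by rewrite fE invrK.
move=> F F' /set_mem/AutE[b Bb ->] /set_mem/AutE[b' Bb' ->].
have -> : (fun q => q * frame_map u v b) \o (fun q => q * frame_map u v b') =
    (fun q => q * frame_map u v (b' * b)).
  by apply/funext => q; rewrite /= frame_mapM // mulrA.
rewrite !fE invrM ?frame_mapM //.
  exact/unit_quat_unit/(S3_unit Bsub).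
exact/unit_quat_unit/(S3_unit Bsub).
Qed.

Lemma pm_id_Aut : @pm_id R `<=` Aut_torus L.
Proof.
rewrite Aut_torusE => _ [] ->.
  exists 1; first exact: S3_1 stabilizer_subgroup.
  by apply/funext => q; rewrite mulr1.
by exists (-1); [exact: stabilizerN1|apply/funext => q; rewrite mulrN1].
Qed.

(** All elements of [{id, -id}] have square [id], and an isomorphism carries
    this property over to [G]. *)
Lemma Aut_isog_not_pm_id G g : subgroup_S3 G -> G g -> g * g <> 1 ->
  Aut_isog L G -> Aut_torus L <> @pm_id R.
Proof.
move=> Gsub Gg gg [f [fG _ fsurj] fM] AutE.
have Aid : Aut_torus L id by apply: pm_id_Aut; left.
have f1 : f id = 1.
  have := fM id id (mem_set Aid) (mem_set Aid).
  rewrite (_ : id \o id = id) // => e.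
  have ui := unit_quat_unit (S3_unit Gsub (fG _ Aid)).
  by apply: (mulrI ui); rewrite -e mulr1.
have [F AF fF] := fsurj _ Gg.
apply: gg; rewrite -fF -fM ?inE // (_ : F \o F = id) //.
move: AF; rewrite AutE => -[->|->] //.
by apply/funext => q /=; rewrite opprK.
Qed.

End Lattice.

End Torus.

(** * Tori with nontrivial automorphisms *)

Theorem theorem8p24 (R : realType) (I J : quat R)
    (hI : imag_units I) (hJ : imag_units J) (hIJ : quat_dot I J = 0)
    (L : set (quat R)) (hL : lattice4 L) :
  Aut_torus L <> @pm_id R <->
  (cyclic_torus I L \/ cyclic_dihedral_torus I L \/ dihedral8_torus I J L \/
   dihedral12_torus I J L \/ tetrahedral_torus I J L).
Proof.
have fIJ : frame I J by [].
have iso_iff : (exists2 G, exceptional I J G & Aut_isog L G) <->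
  (cyclic_torus I L \/ cyclic_dihedral_torus I L \/ dihedral8_torus I J L \/
   dihedral12_torus I J L \/ tetrahedral_torus I J L).
  rewrite /cyclic_torus /cyclic_dihedral_torus /dihedral8_torus
    /dihedral12_torus /tetrahedral_torus /exceptional.
  split=> [[G + iso]|].
    by move=> [|[|[|[|]]]] e; move: iso; rewrite e; tauto.
  by move=> [|[|[|[|]]]] iso; eexists; try exact: iso; tauto.
rewrite -iso_iff; split=> [Aut_pm|[G exG iso]]; last first.
  have [Gsub [g Gg gg]] := exceptional_not_involutive fIJ exG.
  exact: Aut_isog_not_pm_id hL _ _ Gsub Gg gg iso.
have [|u [v [B [fuv GE exB]]]] :=
  integral_trace_classification (stabilizer_subgroup L) (stabilizer_int hL)
    (stabilizerN1 hL); last first.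
  exists (frame_map I J @` B); first exact: frame_exceptional.
  exact: Aut_isog_frame GE.
apply: contrapT => no_g; apply: Aut_pm.
apply/seteqP; split; last exact: pm_id_Aut.
rewrite Aut_torusE => _ [a Ga <-].
have [->|a1] := eqVneq a 1; first by left; apply/funext => q; rewrite mulr1.
have [->|aN1] := eqVneq a (-1).
  by right; apply/funext => q; rewrite mulrN1.
by case: no_g; exists a.
Qed.
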